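(* Let $p>5$ be a prime and $G=\mathrm{PSL}(2,p)$. Every witness to failure for $G$ has order $2$ or $3$. If moreover $p\not\equiv \pm 1 \pmod{10}$, every witness to failure for $G$ has order $2$.
   Context: For a finite group $G$, a sequence $s=(g_1,\dots,g_n)\in G^n$ is a generating sequence if $G=\langle g_1,\dots,g_n\rangle$; it is irredundant if no proper subsequence of $s$ generates $G$. Let $m(G)$ be the largest length of an irredundant generating sequence of $G$. A nontrivial element $g\in G$ is a witness to failure if there exists an irredundant generating sequence $s=(g_1,\dots,g_m)$ of $G$ of length $m=m(G)$ such that for no $i\in\{1,\dots,m\}$ does $(g_1,\dots,g_{i-1},g,g_{i+1},\dots,g_m)$ generate $G$. *)

(* Defs.v *)
From HB Require Import structures.
From mathcomp Require Import all_boot all_order all_algebra all_fingroup all_solvable.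
Set Implicit Arguments. Unset Strict Implicit. Unset Printing Implicit Defensive.
Import GRing.Theory.

Section Gen.
Variable gT : finGroupType.
Implicit Types (G : {group gT}) (s : seq gT).

Definition gen_seq G s : Prop := <<[set x in s]>>%g = G.

Definition irr_gen_seq G s : Prop :=
  gen_seq G s /\ forall t, subseq t s -> t != s -> ~ gen_seq G t.

Definition is_m G (mG : nat) : Prop :=
  (exists s, irr_gen_seq G s /\ size s = mG) /\
  (forall s, irr_gen_seq G s -> size s <= mG).

Definition witness_to_failure G (g : gT) : Prop :=
  g \in G /\ g != 1%g /\
  exists s, [/\ irr_gen_seq G s, is_m G (size s) &
    forall i, i < size s -> ~ gen_seq G (set_nth 1%g s i g)].
End Gen.

Section PSL.
Variable p : nat.

Definition SL2_set : {set {'GL_2['F_p]}} :=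
  [set u : {'GL_2['F_p]} | (\det (GLval u) == 1)%R].

Lemma SL2_group_set : group_set SL2_set.
Proof.
apply/group_setP; split; first by rewrite inE GL_1E det1.
move=> x y; rewrite !inE GL_ME det_mulmx => /eqP-> /eqP->.
by rewrite mulr1.
Qed.

Canonical SL2_group := Group SL2_group_set.

Definition SL2 : {group {'GL_2['F_p]}} := SL2_group.

Definition PSL2 : {group coset_of 'Z(SL2)} := (SL2 / 'Z(SL2))%G.
End PSL.

(* Main.v *)
Require Import Defs.
From mathcomp Require Import all_boot all_order all_algebra all_fingroup all_solvable.
From mathcomp Require Import ring zify.
Set Implicit Arguments. Unset Strict Implicit. Unset Printing Implicit Defensive.
Import GRing.Theory.

(* Let Z be the center of L = SL(2,p), and let g in L/Z have order at least 4,
   or order 3 if 5 does not divide |L|. If g cannot replace any member of an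
   irredundant generating sequence s, then for every i some maximal subgroup M_i
   contains g and all members of s but the i-th. As |s| >= 3, each member of s
   lies in some M_j :&: M_k with M_j != M_k, and such an intersection normalises
   <g>. So <g> is normal in L/Z, which is absurd. That |s| >= 3 holds because L/Z
   is generated by three involutions, and two involutions generate a soluble
   group.
   A maximal subgroup of order divisible by p normalises a Sylow p-subgroup, and
   then the intersection is abelian. For a p'-subgroup the class equation over its
   partition into tori shows that, modulo Z, it normalises <g> or has order 12, 24
   or 60, with 12 excluded for order >= 4. So the order of the intersection forces
   it to equal M_j, or to be normal of index 2 in both M_j and M_k, hence in L. No
   isomorphism type of a subgroup is ever needed. *)

(* The numerical data of a conjugacy class of tori, all orders modulo the center:
   [h] is the order of the group, [a] that of a torus, [n] the index of its
   normaliser, [k] the number of noncentral elements of the class in the double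
   cover; [q] is the index of the torus, which is [n] or [2 n]. *)

Definition class_size (h k a n : nat) : Prop :=
  exists q, [/\ 2 <= a, a * q = h, q = n \/ q = n.*2 & k = (a.*2 - 2) * n].

(** * Integer solutions of the class equation *)

Lemma class_sizeE h k a n : 0 < h -> class_size h k a n ->
  exists q, [/\ 0 < q, (q = n /\ k = h.*2 - q.*2) \/ (q = n.*2 /\ k = h - q) &
    [\/ a = 2 /\ 2 * q = h, a = 3 /\ 3 * q = h, a = 4 /\ 4 * q = h |
     a = 5 /\ 5 * q = h \/ 6 <= a /\ 6 * q <= h]].
Proof.
move=> h0 [q [a2 aq qn ->]]; exists q; split; first by nia.
  by case: qn => e; [left | right]; split=> //; nia.
case: a a2 aq => [|[|[|[|[|[|a]]]]]] // _ aq; first [by constructor 1 | by constructor 2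
  | by constructor 3 | by constructor 4; left | by constructor 4; right; split=> //; nia].
Qed.

(** After division by [h], terms [2 (1 - 1 / a)] or [1 - 1 / a] add up to [2 - 2 / h]. The first is
    at least 2/3 and every other at least 1/2, so four classes are too many. With fewer classes,
    [2 <= n1] discards the dihedral solutions and leaves only those listed. *)
Lemma class_equation h k1 a1 n1 (D := h.*2 - 2) : 1 < h ->
  class_size h k1 a1 n1 -> 3 <= a1 -> 2 <= n1 ->
  [\/ k1 = D,
      exists k2 a2 n2, class_size h k2 a2 n2 /\ k1 + k2 = D,
      exists k2 a2 n2 k3 a3 n3,
        [/\ class_size h k2 a2 n2, class_size h k3 a3 n3 & k1 + k2 + k3 = D]
    | exists k2 a2 n2 k3 a3 n3 k4 a4 n4, [/\ class_size h k2 a2 n2, class_size h k3 a3 n3,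
        class_size h k4 a4 n4 & k1 + k2 + k3 + k4 <= D]] ->
  h \in [:: 12; 24; 60] /\ (4 <= a1 -> h \in [:: 24; 60]).
Proof.
rewrite {}/D => h1 /(class_sizeE (ltnW h1))[q1 [q10 t1 A1]] a3 n2 classes.
have {A1} A1 : [\/ a1 = 3 /\ 3 * q1 = h, a1 = 4 /\ 4 * q1 = h
    | a1 = 5 /\ 5 * q1 = h \/ 6 <= a1 /\ 6 * q1 <= h].
  by case: A1 => [[? ?]|?|?|?]; [lia|constructor 1|constructor 2|constructor 3].
suff : (a1 = 3 /\ (h = 12 \/ h = 24 \/ h = 60)) \/ (a1 = 4 /\ h = 24) \/ (a1 = 5 /\ h = 60).
  by case=> [[-> [->|[->|->]]]|[[-> ->]|[-> ->]]].
have {t1} t1 : (2 <= q1 /\ k1 + q1.*2 = h.*2) \/ (4 <= q1 /\ k1 + q1 = h).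
  by case: A1 t1 => [[_]|[_]|[[_]|[_]]] ? [[]|[]]; lia.
have X k a n : class_size h k a n -> exists q,
  [/\ k + q.*2 = h.*2 \/ k + q = h & [\/ 2 * q = h, 3 * q = h, 4 * q = h | 5 * q = h \/ 6 * q <= h]].
  case/(class_sizeE (ltnW h1)) => q [q0 t A]; exists q; split.
    by case: A t => [[_]|[_]|[_]|[[_]|[_]]] ? [[]|[]]; lia.
  by case: A => [[_]|[_]|[_]|[[_]|[_]]] ?; [constructor 1|constructor 2|constructor 3|
    constructor 4; left|constructor 4; right].
case: classes => [e|[k2 [b2 [m2 [/X[q2 [t2 A2]] e]]]]
 |[k2 [b2 [m2 [k3 [b3 [m3 [/X[q2 [t2 A2]] /X[q3 [t3 A3]] e]]]]]]]
 |[k2 [b2 [m2 [k3 [b3 [m3 [k4 [b4 [m4 [/X[q2 [t2 A2]] /X[q3 [t3 A3]] /X[q4 [t4 A4]] e]]]]]]]]]]].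
- by case: t1 A1 => -[? ?] [[? ?]|[? ?]|[[? ?]|[? ?]]]; lia.
- by case: t1 A1 t2 A2 => -[? ?] [[? ?]|[? ?]|[[? ?]|[? ?]]] [?|?] [?|?|?|[?|?]]; lia.
- have B2 : 2 * q2 <= h by case: A2 => [||| []]; lia.
  have B3 : 2 * q3 <= h by case: A3 => [||| []]; lia.
  have B1 : 3 * q1 <= h by case: A1 => [[]|[]|[[]|[]]]; lia.
  case: t1 => -[? ?]; first by case: t2 t3 => [?|?] [?|?]; lia.
  case: t2 => ?; first by case: t3 => ?; lia.
  case: t3 => ?; first by lia.
  by case: A1 A2 A3 => [[? ?]|[? ?]|[[? ?]|[? ?]]] [?|?|?|[?|?]] [?|?|?|[?|?]]; lia.
have B2 : 2 * q2 <= h by case: A2 => [||| []]; lia.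
have B3 : 2 * q3 <= h by case: A3 => [||| []]; lia.
have B4 : 2 * q4 <= h by case: A4 => [||| []]; lia.
have B1 : 3 * q1 <= h by case: A1 => [[]|[]|[[]|[]]]; lia.
by case: t1 t2 t3 t4 => -[? ?] [?|?] [?|?] [?|?]; lia.
Qed.

(** Among 12, 24 and 60 the only proper quotients are 24 / 12 = 2 and 60 / 12 = 5; the last
    hypothesis excludes the second. *)
Lemma proper_overgroup_index d h i : i * d = h -> 1 < i ->
  d \in [:: 12; 24; 60] -> h \in [:: 12; 24; 60] ->
  d \in [:: 24; 60] \/ h != 60 -> i = 2.
Proof.
move=> e i1; rewrite !inE => dE hE d4.
case/or3P: dE d4 e => /eqP-> d4 e; case/or3P: hE d4 e => /eqP->; lia.
Qed.

(** * The class equation of a p'-subgroup *)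

Section Classification.
Local Open Scope group_scope.
Variables (gT : finGroupType) (Z H : {group gT}).
Hypotheses (cardZ : #|Z| = 2) (sZH : Z \subset H) (cZH : H \subset 'C(Z)).
Hypothesis centr_trans : forall x y z, x \in H :\: Z ->
  commute x y -> commute x z -> commute y z.
Hypothesis conj_centr : forall x y, x \in H :\: Z -> y \in H ->
  commute x (x ^ y) -> x ^ y = x \/ x ^ y = x^-1.
Implicit Types x y z : gT.

(** For noncentral [x], the torus is [A x]: by [centr_trans] it is abelian and is the centraliser in
    [H] of each of its noncentral elements. *)
Local Notation A x := 'C_H[x].
Local Notation B x := ('C_H[x] :\: Z).
Local Notation K x := (class_support ('C_H[x] :\: Z) H).

Lemma mem_cent1H x y : (y \in A x) = (y \in H) && (y \in 'C[x]).
Proof. by rewrite inE. Qed.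

Lemma nZH : H \subset 'N(Z).
Proof. exact: subset_trans cZH (cent_sub Z). Qed.

Lemma sub_center_cent1 x : x \in H -> Z \subset A x.
Proof. by move=> Hx; rewrite subsetI sZH sub_cent1 (subsetP cZH). Qed.

Lemma mem_torus x : x \in H :\: Z -> x \in B x.
Proof. by case/setDP => Hx nZx; rewrite in_setD nZx mem_cent1H Hx cent1id. Qed.

Lemma torus_eq x y : x \in H :\: Z -> y \in B x -> A y = A x.
Proof.
move=> Xx /setDP[/setIP[Hy /cent1P cyx] nZy].
have Xy : y \in H :\: Z by rewrite inE nZy.
apply/setP => z; rewrite !mem_cent1H; case: (z \in H) => //=.
apply/cent1P/cent1P => h; apply/commute_sym.
  exact: (centr_trans Xy) (commute_sym h).
by apply: (centr_trans Xx) (commute_sym h); apply: commute_sym.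
Qed.

Lemma torusJ x y : y \in H -> A (x ^ y) = A x :^ y.
Proof. by move=> Hy; rewrite conjIg conjGid // cent1J. Qed.

Lemma noncentralJ x y : x \in H :\: Z -> y \in H -> x ^ y \in H :\: Z.
Proof.
by case/setDP=> Hx nZx Hy; rewrite in_setD (memJ_norm _ (subsetP nZH _ Hy)) nZx groupJ.
Qed.

Lemma torus_sub x : B x \subset H :\: Z.
Proof. by rewrite setSD // subsetIl. Qed.

(** Conjugate tori that share a noncentral element coincide, both being its centraliser. *)
Lemma torus_TI x : x \in H :\: Z -> normedTI (B x) H 'N_H(A x).
Proof.
move=> Xx; apply/normedTI_memJ_P; split.
- by apply/set0Pn; exists x; apply: mem_torus.
- exact: subsetIl.
move=> a g Ba Hg; have Xa := subsetP (torus_sub x) _ Ba.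
rewrite [in RHS]inE Hg /=; apply/idP/idP => [Bag | Ng].
  apply/normP; rewrite -[in LHS](torus_eq Xx Ba) -torusJ //.
  exact: torus_eq Bag.
have nZg := subsetP nZH _ Hg.
by case/setDP: Ba => Aa nZa; rewrite inE (memJ_norm _ Ng) Aa memJ_norm // nZa.
Qed.

(** The normaliser moves [x] inside its torus, hence only to [x] or its inverse, and the stabiliser
    of [x] is the torus. *)
Lemma torus_norm_index x : x \in H :\: Z -> #|'N_H(A x) : A x| <= 2.
Proof.
move=> Xx; have [Hx _] := setDP Xx.
have e : A x = 'C_('N_H(A x))[x].
  apply/setP => z; rewrite inE [in RHS]inE [z \in 'N_H(_)]inE.
  case Hz: (z \in H) => //=; case cz: (z \in 'C[x]); rewrite ?andbF // andbT.
  by rewrite (subsetP (normG [group of A x])) // mem_cent1H Hz cz.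
rewrite [X in #|_ : X|]e index_cent1.
apply: leq_trans (_ : #|[set x; x^-1]| <= 2); last by rewrite cards2; case: eqP.
apply/subset_leq_card/subsetP => _ /imsetP[y /setIP[Hy Ny] ->].
have : x ^ y \in A x by rewrite memJ_norm // mem_cent1H Hx cent1id.
rewrite mem_cent1H => /andP[_ /cent1P/commute_sym/(conj_centr Xx Hy)].
by case=> ->; rewrite !inE eqxx ?orbT.
Qed.

Lemma torus_class_size x : x \in H :\: Z ->
  class_size #|H : Z| #|K x| #|A x : Z| #|H : 'N_H(A x)|.
Proof.
move=> Xx; have [Hx nZx] := setDP Xx.
have sZA := sub_center_cent1 Hx; have sAH : A x \subset H := subsetIl _ _.
have sNH : 'N_H(A x) \subset H := subsetIl _ _.
have sAN : A x \subset 'N_H(A x) by rewrite subsetI sAH normG.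
exists #|H : A x|; split.
- rewrite indexg_gt1; apply/negP => /subsetP/(_ x)/implyP.
  by rewrite mem_cent1H Hx cent1id (negbTE nZx).
- by rewrite mulnC Lagrange_index.
- rewrite -(Lagrange_index sNH sAN); have := torus_norm_index Xx.
  have := indexg_gt0 'N_H(A x) (A x).
  by case: #|_ : A x| => [|[|[|]]] // _ _; [left; rewrite muln1 | right; rewrite muln2].
rewrite (card_support_normedTI (torus_TI Xx)) cardsD (setIidPr sZA) cardZ.
by rewrite -(Lagrange sZA) cardZ mul2n.
Qed.

Lemma class_torus_sub x : K x \subset H :\: Z.
Proof.
apply/subsetP => _ /imset2P[a g Ba Hg ->]; apply: noncentralJ => //.
exact: (subsetP (torus_sub x)).
Qed.

Lemma class_torus_disjoint x y : x \in H :\: Z -> y \in H :\: Z -> y \notin K x ->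
  K x :&: K y = set0.
Proof.
move=> Xx Xy; apply: contraNeq => /set0Pn[_ /setIP[/imset2P[a g Ba Hg ->] /imset2P[b h Bb Hh e]]].
have Xa := subsetP (torus_sub x) _ Ba.
(* A common element of both classes makes a conjugate of [y] commute with [a], which puts it in the
   torus of [x]. *)
have : y ^ (h * g^-1) \in B x.
  have yb : commute y b by case/setDP: Bb => /setIP[_ /cent1P/commute_sym].
  have : commute (a ^ g) (y ^ h) by rewrite e /commute -(conjMg b) -(conjMg y) yb.
  move/(congr1 (conjg^~ g^-1)); rewrite /= (conjMg (a ^ g)) (conjMg (y ^ h)) conjgK -conjgM => c.
  have : y ^ (h * g^-1) \in H :\: Z by rewrite noncentralJ // groupM ?groupV.
  rewrite !in_setD => /andP[-> Hc]; rewrite -(torus_eq Xx Ba) mem_cent1H Hc.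
  by apply/cent1P/commute_sym.
move/memJ_class_support => /(_ H (g * h^-1)); rewrite groupM ?groupV // => /(_ isT).
by rewrite -conjgM mulgA mulgKV mulgV conjg1.
Qed.

(* [H / Z] is partitioned by the conjugates of its tori, so its order satisfies
   the class equation of the finite rotation groups. *)
Lemma torus_classification x : x \in H -> 3 <= #[coset Z x] ->
  [\/ forall y, y \in H -> x ^ y = x \/ x ^ y = x^-1
    | #|H : Z| \in [:: 12; 24; 60] /\ (4 <= #[coset Z x] -> #|H : Z| \in [:: 24; 60])].
Proof.
move=> Hx x3.
have nZx : x \notin Z by apply: contraTN x3 => Zx; rewrite coset_id // order1.
have Xx : x \in H :\: Z by rewrite inE nZx.
have sZA := sub_center_cent1 Hx.
have xA : #[coset Z x] <= #|A x : Z|.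
  have nZA : A x \subset 'N(Z) := subset_trans (subsetIl _ _) nZH.
  rewrite -card_quotient // orderE; apply/subset_leq_card.
  by rewrite cycle_subG mem_quotient // mem_cent1H Hx cent1id.
(* A normal torus gives the first alternative; otherwise its normaliser has index at least 2, as the
   class equation requires. *)
have [sHN|nHN] := boolP (H \subset 'N(A x)).
  left=> y Hy; apply: (conj_centr Xx Hy).
  have : x ^ y \in A x by rewrite memJ_norm ?(subsetP sHN) // mem_cent1H Hx cent1id.
  by rewrite mem_cent1H => /andP[_ /cent1P/commute_sym].
right.
have n2 : 2 <= #|H : 'N_H(A x)| by rewrite indexg_gt1 subsetI subxx.
have hZ : #|H| = #|H : Z|.*2 by rewrite -(Lagrange sZH) cardZ mul2n.
have h1 : 1 < #|H : Z|.
  by rewrite indexg_gt1; apply/negP => /subsetP/(_ x Hx); rewrite (negbTE nZx).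
have cX : #|H :\: Z| = #|H : Z|.*2 - 2 by rewrite cardsD (setIidPr sZH) cardZ hZ.
suff : #|H : Z| \in [:: 12; 24; 60] /\ (4 <= #|A x : Z| -> #|H : Z| \in [:: 24; 60]).
  by case=> -> h4; split=> // d4; apply/h4/(leq_trans d4).
apply: (class_equation h1 (torus_class_size Xx) (leq_trans x3 xA) n2).
(* Classes are removed one at a time; what is left stays a union of classes. After four removals an
   inequality is enough. *)
have stD (R : {set gT}) y : R \subset H :\: Z -> y \in R ->
    (forall z, z \in R -> K z \subset R) ->
    #|R| = #|K y| + #|R :\: K y| /\ (forall z, z \in R :\: K y -> K z \subset R :\: K y).
  move=> sR Ry stR; split; first by rewrite -(cardsID (K y) R) (setIidPr (stR _ Ry)).
  move=> z /setDP[Rz nz]; rewrite subsetD stR // -setI_eq0 setIC.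
  by apply/eqP/class_torus_disjoint => //; apply: (subsetP sR).
have sub0 (R S : {set gT}) : R \subset H :\: Z -> R :\: S \subset H :\: Z.
  by apply: subset_trans; apply: subsetDl.
have [c0 st1] := stD _ _ (subxx _) Xx (fun y _ => class_torus_sub y); rewrite -cX c0.
have [->|[y1 Ry1]] := set_0Vmem ((H :\: Z) :\: K x); first by rewrite cards0 addn0; constructor 1.
have sR1 := sub0 _ (K x) (subxx _); have Xy1 := subsetP sR1 _ Ry1.
have [-> st2] := stD _ _ sR1 Ry1 st1; have sR2 := sub0 _ (K y1) sR1.
move: {Ry1 st1} (_ :\: K y1) sR2 st2 => R2 sR2 st2.
have [->|[y2 Ry2]] := set_0Vmem R2.
  rewrite cards0 addn0; constructor 2; do 3!eexists; split; last by [].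
  exact: torus_class_size Xy1.
have Xy2 := subsetP sR2 _ Ry2.
have [-> st3] := stD _ _ sR2 Ry2 st2; have sR3 := sub0 _ (K y2) sR2.
move: {Ry2 st2} (_ :\: K y2) sR3 st3 => R3 sR3 st3.
have [->|[y3 Ry3]] := set_0Vmem R3.
  rewrite cards0 addn0 addnA; constructor 3; do 6!eexists; split; last by [].
    exact: torus_class_size Xy1.
  exact: torus_class_size Xy2.
have Xy3 := subsetP sR3 _ Ry3.
have [-> _] := stD _ _ sR3 Ry3 st3.
constructor 4; do 9!eexists; split.
- exact: torus_class_size Xy1.
- exact: torus_class_size Xy2.
- exact: torus_class_size Xy3.
by rewrite !addnA leq_addr.
Qed.

End Classification.

(** * Replacement in generating sequences *)

Section Replacement.
Local Open Scope group_scope.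
Variable gT : finGroupType.
Implicit Types (G M N : {group gT}) (g u v : gT).

Lemma maximal_eq G M N : maximal M G -> M \subset N -> N \proper G -> N :=: M.
Proof. by case/maxgroupP => _ maxM sMN pN; apply: maxM. Qed.

Lemma replacement G g (s0 : seq gT) :
  ~~ (G \subset 'N(<[g]>)) ->
  (forall M M' : {group gT}, maximal M G -> maximal M' G -> M != M' ->
     g \in M -> g \in M' -> M :&: M' \subset 'N(<[g]>)) ->
  irr_gen_seq G s0 -> 2 < size s0 -> ~ witness_to_failure G g.
Proof.
move=> nNg cap irr0 s0_gt2 [Gg [_ [s [[genG _] [_ maxs] fail]]]].
(* The witnessing sequence has maximal length, so any irredundant sequence bounds it from below. *)
have s_gt2 : 2 < size s := leq_trans s0_gt2 (maxs _ irr0).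
(* Failure at position [i] confines the modified sequence to a maximal subgroup, which must miss the
   old member, since it would otherwise contain all of [s]. *)
have max_i i : i < size s -> exists M : {group gT}, [/\ maximal M G, g \in M,
    nth 1 s i \notin M & forall j, j < size s -> j != i -> nth 1 s j \in M].
  move=> lti; pose t := set_nth 1 s i g.
  have st : size t = size s by rewrite size_set_nth (maxn_idPr lti).
  have Gs : {subset s <= G} by move=> x sx; rewrite -genG mem_gen ?inE.
  have tP x : x \in t -> x \in G.
    case/(nthP 1) => j; rewrite st => ltj <-; rewrite nth_set_nth /=.
    by case: eqP => // _; apply/Gs/mem_nth.
  have sTG : <<[set x in t]>> \subset G by rewrite gen_subG; apply/subsetP => x; rewrite inE; apply: tP.
  case: (maximal_exists sTG) => [/(fail i lti)//|[M maxM sTM]].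
  have MT x : x \in t -> x \in M by move=> tx; apply: (subsetP sTM); rewrite mem_gen ?inE.
  have Mj j : j < size s -> j != i -> nth 1 s j \in M.
    move=> ltj neq; apply: MT; rewrite -[nth 1 s j](_ : nth 1 t j = _) ?mem_nth ?st //.
    by rewrite nth_set_nth /= (negbTE neq).
  exists M; split=> //.
    by apply: MT; rewrite -{1}[g](_ : nth 1 t i = _) ?mem_nth ?st // nth_set_nth /= eqxx.
  apply/negP => Mi; have := maxgroupp maxM; rewrite properE => /andP[_ /negP[]].
  rewrite -genG gen_subG; apply/subsetP => x; rewrite inE => /(nthP 1)[j ltj <-].
  by have [->|neq] := eqVneq j i; [|apply: Mj].
case/negP: nNg; rewrite -genG gen_subG; apply/subsetP => x; rewrite inE => /(nthP 1)[i lti <-].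
(* Length at least 3 leaves two further positions; their maximal subgroups differ, and both contain
   member [i]. *)
have [j [k [ltj ltk ji ki jk]]] : exists j k, [/\ j < size s, k < size s, i != j, i != k & j != k].
  case: i {lti} => [|[|i]]; [exists 1%N, 2%N | exists 0%N, 2%N | exists 0%N, 1%N]; split=> //; lia.
have [M [maxM Mg nMj Mi]] := max_i j ltj; have [M' [maxM' Mg' nMk Mi']] := max_i k ltk.
apply: (subsetP (cap M M' maxM maxM' _ Mg Mg')); last by rewrite inE Mi // Mi'.
by apply: contraNneq nMj => ->; apply: Mi'.
Qed.

(** Both generators normalise the cyclic group of [u * v], and modulo it the group is generated by
    the image of [u] alone. *)
Lemma der_dihedral u v : u ^+ 2 = 1 -> v ^+ 2 = 1 -> <<[set u; v]>>^`(1) \subset <[u * v]>.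
Proof.
move=> u2 v2; have uV : u^-1 = u by apply/eqP; rewrite eq_invg_mul; apply/eqP.
have vV : v^-1 = v by apply/eqP; rewrite eq_invg_mul; apply/eqP.
have Nu : u \in 'N(<[u * v]>).
  rewrite inE -cycleJ cycle_subG -[_ ^ u]invgK groupV.
  by rewrite conjgE !mulgA mulVg mul1g !invMg uV vV cycle_id.
have Nuv : u * v \in 'N(<[u * v]>) by rewrite (subsetP (normG _)) ?cycle_id.
have Nv : v \in 'N(<[u * v]>) by rewrite -(groupMl v Nu).
apply: der1_min; first by rewrite gen_subG; apply/subsetP => z /set2P[]->.
have sW : <<[set u; v]>> \subset <[u]> <*> <[u * v]>.
  rewrite gen_subG; apply/subsetP => z /set2P[]->.
    by rewrite (subsetP (joing_subl _ _)) ?cycle_id.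
  rewrite -{1}(mulKg u v).
  apply: groupM; first by rewrite groupV (subsetP (joing_subl _ _)) ?cycle_id.
  by rewrite (subsetP (joing_subr _ _)) ?cycle_id.
apply: abelianS (quotientS _ sW) _.
by rewrite quotientYidr ?cycle_subG // quotient_abelian // cycle_abelian.
Qed.

(** At most two members would generate a group with cyclic derived subgroup, impossible for a
    nontrivial perfect group. *)
Lemma perfect_three_involutions G i j k : G^`(1) = G -> G :!=: 1 ->
  i ^+ 2 = 1 -> j ^+ 2 = 1 -> k ^+ 2 = 1 -> <<[set i; j; k]>> = G ->
  irr_gen_seq G [:: i; j; k].
Proof.
move=> perf ntG i2 j2 k2 genG; split.
  by rewrite /gen_seq -genG; congr <<_>>; apply/setP => x; rewrite !inE orbA.
move=> t subt neqt gent; have := size_subseq_leqif subt.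
move/ltn_leqif; rewrite neqt /= => szt.
have inv x : x \in t -> x ^+ 2 = 1.
  by move/(mem_subseq subt); rewrite !inE => /or3P[]/eqP->.
have dihedral u v : u ^+ 2 = 1 -> v ^+ 2 = 1 -> <<[set u; v]>> = G -> False.
  move=> u2 v2 genuv; have := der_dihedral u2 v2; rewrite genuv perf => /abelianS.
  move/(_ (cycle_abelian _))/derG1P; rewrite perf => G1; by rewrite G1 eqxx in ntG.
case: t gent szt inv {subt neqt} => [|u [|v [|]]] // gent _ inv.
- case/eqP: ntG; rewrite -gent (_ : [set x in [::]] = set0) ?gen0 //.
- apply: (@dihedral u u); rewrite ?inv ?inE ?eqxx // -gent setUid; congr <<_>>.
  by apply/setP => x; rewrite !inE.
apply: (@dihedral u v); rewrite ?inv ?inE ?eqxx ?orbT // -gent; congr <<_>>.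
by apply/setP => x; rewrite !inE.
Qed.
End Replacement.

(** * Intersections of maximal subgroups *)

Section MaximalIntersections.
Local Open Scope group_scope.
Variables (p : nat) (hp : prime p) (gT : finGroupType) (L : {group gT}).
Local Notation Z := 'Z(L).
Implicit Types (H D Q : {group gT}) (x y z : gT).
(** These hypotheses isolate what the argument uses about SL(2,p); they are established below by
    computing with matrix entries. *)
Hypothesis cardZ : #|Z| = 2.
Hypothesis centr_trans : forall x y z, x \in L -> x \notin Z ->
  commute x y -> commute x z -> commute y z.
Hypothesis conj_centr : forall x y, x \in L -> x \notin Z -> ~~ (p %| #[x]) ->
  y \in L -> commute x (x ^ y) -> x ^ y = x \/ x ^ y = x^-1.
Hypothesis perfect : L^`(1) = L.
Hypothesis quasisimple : forall N : {group gT}, N <| L -> ~~ (N \subset Z) -> N :=: L.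
Hypothesis p_subgroup : forall H, H \subset L -> p %| #|H| -> ~~ (L \subset H) ->
  exists Q : {group gT}, [/\ p.-Sylow(L) Q, Q \subset H, H \subset 'N(Q) & 'N_L(Q)^`(1) \subset Q].
Hypothesis p_dvd : logn p #|L| = 1%N.

Lemma p'subgroup_classification H x : Z \subset H -> H \subset L -> ~~ (p %| #|H|) ->
  x \in H -> 3 <= #[coset Z x] ->
  [\/ forall y, y \in H -> x ^ y = x \/ x ^ y = x^-1
    | #|H : Z| \in [:: 12; 24; 60] /\ (4 <= #[coset Z x] -> #|H : Z| \in [:: 24; 60])].
Proof.
move=> sZH sHL p'H.
have LX y : y \in H :\: Z -> y \in L /\ y \notin Z.
  by case/setDP=> Hy nZy; rewrite (subsetP sHL).
apply: (torus_classification (Z := [group of Z])) => //.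
- by rewrite centsC (subset_trans _ (centS sHL)) // subsetIr.
- by move=> y z t /LX[Ly nZy]; apply: centr_trans.
move=> y z Xy Hz; have [Ly nZy] := LX _ Xy; apply: conj_centr => //.
  by apply: contra p'H => /dvdn_trans; apply; apply: order_dvdG; case/setDP: Xy.
exact: (subsetP sHL).
Qed.

Lemma maximal_eqL H H' : maximal H L -> maximal H' L -> H \subset H' -> H = H'.
Proof.
by move=> maxH maxH' sHH'; apply: group_inj; rewrite (maximal_eq maxH sHH') // (maxgroupp maxH').
Qed.

(** Here [H] is the normaliser of a Sylow subgroup [Q] of order [p]. If [H'] contained [Q], it would
    be the same normaliser; so [Q] meets [H'] trivially, while the derived subgroup of the
    intersection lies in [Q]. *)
Lemma p_maximal_cap_abelian H H' : maximal H L -> maximal H' L -> H != H' ->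
  p %| #|H| -> abelian (H :&: H').
Proof.
move=> maxH maxH' neqH pH.
have [sHL nLH] := andP (maxgroupp maxH); have [sHL' nLH'] := andP (maxgroupp maxH').
have [Q [sylQ sQH nQH derQ]] := p_subgroup sHL pH nLH.
have cardQ : #|Q| = p by rewrite (card_Hall sylQ) p_part p_dvd expn1.
(* The normaliser is proper: otherwise perfectness would put [L] inside [R], hence inside [K]. *)
have maxN (R K : {group gT}) : R \subset K -> K \subset 'N(R) -> 'N_L(R)^`(1) \subset R ->
    maximal K L -> K :=: 'N_L(R).
  move=> sRK nRK derR maxK; have [sKL nLK] := andP (maxgroupp maxK).
  apply/esym; apply: (maximal_eq maxK); first by rewrite subsetI sKL.
  rewrite properE subsetIl; apply: contra nLK => sLN; apply: subset_trans sRK.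
  by rewrite -perfect; apply: subset_trans derR; rewrite dergS // subsetI subxx (subset_trans sLN) ?subsetIr.
have QD : Q :&: (H :&: H') = 1.
  apply: prime_TIg; first by rewrite cardQ.
  apply: contra neqH; rewrite subsetI sQH /= => sQH'.
  have pH' : p %| #|H'| by rewrite -cardQ cardSg.
  have [Q' [sylQ' sQH2 nQH' derQ']] := p_subgroup sHL' pH' nLH'.
  have eQ : Q :=: Q'.
    apply/eqP; rewrite eqEcard (card_Hall sylQ) (card_Hall sylQ') leqnn andbT.
    have sylQ'H' : p.-Sylow(H') Q' := pHall_subl sQH2 sHL' sylQ'.
    rewrite (sub_normal_Hall sylQ'H') ?(pHall_pgroup sylQ) //.
    by rewrite /normal sQH2.
  apply/eqP/group_inj; rewrite (maxN Q H) // (maxN Q' H') //.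
  by rewrite eQ.
apply/derG1P/trivgP; rewrite -QD subsetI der_sub andbT.
apply: subset_trans derQ; apply: dergS.
by rewrite (subset_trans (subsetIl _ _)) // subsetI sHL.
Qed.

Lemma maximal_cap_norm H H' x : maximal H L -> maximal H' L -> H != H' ->
    Z \subset H -> Z \subset H' -> x \in H -> x \in H' ->
    3 <= #[coset Z x] -> (4 <= #[coset Z x] \/ ~~ (5 %| #|L|)) ->
  H :&: H' \subset 'N(<[x]>).
Proof.
move=> maxH maxH' neqH sZH sZH' Hx Hx' x3 x4.
have [sHL nLH] := andP (maxgroupp maxH); have [sHL' nLH'] := andP (maxgroupp maxH').
have Dx : x \in H :&: H' by rewrite inE Hx.
have abel_norm : abelian (H :&: H') -> H :&: H' \subset 'N(<[x]>).
  by move=> abD; rewrite (subset_trans abD) // (subset_trans (centS _) (cent_sub _)) ?cycle_subG.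
have [pH|p'H] := boolP (p %| #|H|); first exact/abel_norm/p_maximal_cap_abelian.
have [pH'|p'H'] := boolP (p %| #|H'|).
  by apply: abel_norm; rewrite setIC; apply: p_maximal_cap_abelian; rewrite // eq_sym.
pose D := (H :&: H')%G.
have sDH : D \subset H := subsetIl _ _; have sDH' : D \subset H' := subsetIr _ _.
have sZD : Z \subset D by rewrite subsetI sZH.
have p'D : ~~ (p %| #|D|) by apply: contra p'H => /dvdn_trans; apply; apply: cardSg.
have inv_norm (K : {group gT}) : (forall y, y \in K -> x ^ y = x \/ x ^ y = x^-1) -> K \subset 'N(<[x]>).
  move=> inv; apply/subsetP => y /inv e; rewrite inE -cycleJ cycle_subG.
  by case: e => ->; rewrite ?groupV cycle_id.
have [/inv_norm //|[cD cD4]] := p'subgroup_classification sZD (subset_trans sDH sHL) p'D Dx x3.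
have [/inv_norm sN|[cH _]] := p'subgroup_classification sZH sHL p'H Hx x3.
  exact: subset_trans sDH sN.
have [/inv_norm sN|[cH' _]] := p'subgroup_classification sZH' sHL' p'H' Hx' x3.
  exact: subset_trans sDH' sN.
have nDH : 1 < #|H : D|.
  rewrite indexg_gt1; apply: contra neqH => /subset_trans/(_ sDH') sHH'.
  by rewrite (maximal_eqL maxH maxH' sHH').
have nDH' : 1 < #|H' : D|.
  rewrite indexg_gt1; apply: contra neqH => /subset_trans/(_ sDH) sHH'.
  by rewrite (maximal_eqL maxH' maxH sHH').
have eH : (#|H : D| * #|D : Z| = #|H : Z|)%N := Lagrange_index sDH sZD.
have eH' : (#|H' : D| * #|D : Z| = #|H' : Z|)%N := Lagrange_index sDH' sZD.
have dvd5 (K : {group gT}) : K \subset L -> ~~ (5 %| #|L|) -> #|K : Z| != 60.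
  move=> sKL n5; apply: contra n5 => /eqP e; apply: dvdn_trans (cardSg sKL).
  by apply: dvdn_trans (dvdn_indexg K Z); rewrite e.
(* The remaining case has all three orders in {12, 24, 60}; the index 5 = 60 / 12 is excluded by the
   order of [x] or because 5 does not divide the order of [L]. *)
have [e2 e2'] : #|H : D| = 2 /\ #|H' : D| = 2.
  have d4 (K : {group gT}) : K \subset L -> #|D : Z| \in [:: 24; 60] \/ #|K : Z| != 60.
    by case: x4 => [/cD4|n5] sKL; [left | right; apply: dvd5].
  by split; [apply: proper_overgroup_index eH _ _ _ (d4 H sHL)
    | apply: proper_overgroup_index eH' _ _ _ (d4 H' sHL')].
have nDHn := normal_norm (index2_normal sDH e2).
have nDHn' := normal_norm (index2_normal sDH' e2').
(* Normality of [D] in [L] contradicts quasisimplicity, as [D] contains the noncentral [x].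
   Otherwise its normaliser is proper and contains, hence equals, both maximal subgroups. *)
have [sLN|nLN] := boolP (L \subset 'N(D)).
  case/negP: nLH; rewrite -(quasisimple (N := D)) //; first by rewrite /normal sLN (subset_trans sDH).
  apply: contraL x3 => /subsetP/(_ x Dx) Zx.
  by rewrite coset_id // order1.
have pN : 'N_L(D) \proper L by rewrite properE subsetIl subsetI subxx.
case/eqP: neqH; apply: group_inj.
rewrite -(maximal_eq (N := 'N_L(D)%G) maxH) ?subsetI ?sHL //.
by rewrite -(maximal_eq (N := 'N_L(D)%G) maxH') ?subsetI ?sHL'.
Qed.

(** * Passage to the quotient by the center *)

Hypothesis three_involutions : exists i j k,
  [/\ [/\ i \in L, j \in L & k \in L],
      [/\ i ^+ 2 \in Z, j ^+ 2 \in Z & k ^+ 2 \in Z] & L \subset <<[set i; j; k]>>].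

Lemma nZL : L \subset 'N(Z). Proof. exact: normal_norm (center_normal L). Qed.

Lemma quotient_perfect : (L / Z)^`(1) = L / Z.
Proof. by rewrite -quotient_der ?nZL // perfect. Qed.

Lemma nonabelian_quotient : ~~ abelian (L / Z).
Proof.
apply/negP => /(der1_min nZL); rewrite perfect => sLZ.
have /derG1P : abelian L by apply: abelianS sLZ (center_abelian L).
rewrite perfect => L1; have := cardZ; rewrite (trivgP (subset_trans (center_sub L) _)) ?L1 //.
by rewrite cards1.
Qed.

Lemma irr_gen_seq3 : exists s, irr_gen_seq (L / Z)%G s /\ size s = 3.
Proof.
have [i [j [k [[Li Lj Lk] [i2 j2 k2] gen]]]] := three_involutions.
exists [:: coset Z i; coset Z j; coset Z k]; split=> //.
have inv x : x \in L -> x ^+ 2 \in Z -> coset Z x ^+ 2 = 1.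
  by move=> Lx x2; rewrite -morphX ?(subsetP nZL) //= coset_id.
apply: perfect_three_involutions; rewrite ?inv //; first exact: quotient_perfect.
  by apply: contraNneq nonabelian_quotient => ->; apply: abelian1.
apply/eqP; rewrite eqEsubset; apply/andP; split.
  rewrite gen_subG; apply/subsetP => x; rewrite !inE -orbA.
  by case/or3P => /eqP->; apply: mem_quotient.
have sSN : [set i; j; k] \subset 'N(Z).
  rewrite (subset_trans _ nZL) //; apply/subsetP => x.
  by rewrite !inE -orbA => /or3P[] /eqP->.
rewrite /= (subset_trans (quotientS Z gen)) // quotient_gen // genS //.
apply/subsetP => _ /morphimP[x _ Sx ->].
by move: Sx; rewrite !inE -!orbA => /or3P[] /eqP->; rewrite eqxx ?orbT.
Qed.

Lemma witness_order g : witness_to_failure (L / Z)%G g -> 3 <= #[g] ->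
  4 <= #[g] \/ ~~ (5 %| #|L|) -> False.
Proof.
move=> wit g3 g4; have [s [irr sz]] := irr_gen_seq3.
apply: (replacement _ _ irr) (wit); last by rewrite sz.
  (* Were the group of [g] normal, its preimage would be a noncentral normal subgroup, hence all of
     [L], and the quotient would be cyclic. *)
  apply: contra nonabelian_quotient => nLg.
  have nG : <[g]> <| L / Z by rewrite /normal cycle_subG (proj1 wit).
  pose N := (coset Z @*^-1 <[g]>)%G.
  have nN : N <| L by rewrite -(quotientGK (center_normal L)) cosetpre_normal.
  suff eN : N :=: L.
    by have := congr1 (fun A : {set gT} => A / Z) eN; rewrite /= cosetpreK => <-; apply: cycle_abelian.
  apply: quasisimple => //; apply: contraL g3 => sNZ.
  have : N / Z = 1 by apply/trivgP; rewrite -(trivg_quotient Z) quotientS.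
  by rewrite cosetpreK => /eqP; rewrite cycle_eq1 => /eqP->; rewrite order1.
move=> M M' maxM maxM' neqM Mg Mg'.
have /morphimP[x Nx Lx ge] := proj1 wit.
have pre (K : {group coset_of Z}) : maximal K (L / Z) -> maximal (coset Z @*^-1 K) L.
  by rewrite -(cosetpre_maximal K) /= (quotientGK (center_normal L)).
rewrite ge in g3 g4 Mg Mg' *.
have Hx (K : {group coset_of Z}) : coset Z x \in K -> x \in coset Z @*^-1 K.
  by move=> Kx; rewrite mem_morphpre.
have neqH : (coset Z @*^-1 M)%G != (coset Z @*^-1 M')%G.
  apply: contraNneq neqM => /(congr1 val) /= e.
  by apply/eqP/group_inj; rewrite -[LHS](cosetpreK M) e cosetpreK.
have := maximal_cap_norm (pre _ maxM) (pre _ maxM') neqH (sub_cosetpre _) (sub_cosetpre _)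
  (Hx _ Mg) (Hx _ Mg') g3 g4.
move=> /subsetP cap; apply/subsetP => y /setIP[My My'].
have : y \in L / Z by apply: (subsetP (proper_sub (maxgroupp maxM))).
case/morphimP => z Nz Lz ye; rewrite ye in My My' *.
have : z \in 'N(<[x]>) by apply: cap; rewrite inE !mem_morphpre.
rewrite !inE -!cycleJ !cycle_subG -morphJ //= => xz.
by rewrite -quotient_cycle // mem_quotient.
Qed.

End MaximalIntersections.

(** * SL(2) over a prime field *)

Section LinearCombinations.
Variable R : comNzRingType.
Implicit Types l r k X Y : R.
Local Open Scope ring_scope.

(** Reduces an equation to a polynomial identity, once coefficients expressing it through known
    equations are supplied. *)
Lemma lincomb1 l1 r1 k1 X Y : l1 = r1 -> X - Y = k1 * (l1 - r1) -> X = Y.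
Proof. by move=> ->; rewrite subrr mulr0 => /subr0_eq. Qed.

Lemma lincomb2 l1 r1 l2 r2 k1 k2 X Y : l1 = r1 -> l2 = r2 ->
  X - Y = k1 * (l1 - r1) + k2 * (l2 - r2) -> X = Y.
Proof. by move=> -> ->; rewrite !subrr !mulr0 addr0 => /subr0_eq. Qed.

End LinearCombinations.

(** Vectors proportional to one nonzero vector [(b, c, e)] are proportional to each other; a nonzero
    coordinate is cancelled. *)
Lemma parallel_trans (F : fieldType) (b c e b1 c1 e1 b2 c2 e2 : F) :
  ~~ [&& b == 0, c == 0 & e == 0]%R ->
  (b * c1 = c * b1 -> e * b1 = b * e1 -> e * c1 = c * e1 ->
   b * c2 = c * b2 -> e * b2 = b * e2 -> e * c2 = c * e2 ->
  [/\ b1 * c2 = c1 * b2, e1 * b2 = b1 * e2 & e1 * c2 = c1 * e2])%R.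
Proof.
move=> nz h1 h2 h3 h4 h5 h6.
have [b0|bnz] := eqVneq b 0%R; last first.
  have g1 : (b1 * c2 = c1 * b2)%R.
    by apply: (mulfI bnz); apply: (lincomb2 (k1 := - b2) (k2 := b1) h1 h4); ring.
  have g2 : (e1 * b2 = b1 * e2)%R.
    by apply: (mulfI bnz); apply: (lincomb2 (k1 := - b2) (k2 := b1) h2 h5); ring.
  split=> //; apply: (mulfI bnz).
  have h7 : (e * b1 * c2 = e * c1 * b2)%R by rewrite -!mulrA g1.
  have h8 : (b * e2 * c1 = e * b2 * c1)%R by rewrite h5.
  rewrite !mulrA -h2 h7 [RHS]mulrAC h8; ring.
have [c0|cnz] := eqVneq c 0%R; last first.
  have g1 : (b1 * c2 = c1 * b2)%R.
    by apply: (mulfI cnz); apply: (lincomb2 (k1 := - c2) (k2 := c1) h1 h4); ring.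
  have g3 : (e1 * c2 = c1 * e2)%R.
    by apply: (mulfI cnz); apply: (lincomb2 (k1 := - c2) (k2 := c1) h3 h6); ring.
  split=> //; apply: (mulfI cnz).
  have h7 : (e * c1 * b2 = e * b1 * c2)%R by rewrite -!mulrA g1.
  have h8 : (c * e2 * b1 = e * c2 * b1)%R by rewrite h6.
  rewrite !mulrA -h3 h7 [RHS]mulrAC h8; ring.
have enz : e != 0%R by move: nz; rewrite b0 c0 !eqxx.
have z1 : (b1 = 0)%R by apply: (mulfI enz); rewrite h2 b0 mulr0 mul0r.
have z2 : (c1 = 0)%R by apply: (mulfI enz); rewrite h3 c0 mulr0 mul0r.
have z3 : (b2 = 0)%R by apply: (mulfI enz); rewrite h5 b0 mulr0 mul0r.
have z4 : (c2 = 0)%R by apply: (mulfI enz); rewrite h6 c0 mulr0 mul0r.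
by rewrite z1 z2 z3 z4 !mul0r !mulr0.
Qed.

(** * Entries of two-by-two matrices *)

Section GL2Entries.
Local Open Scope group_scope.
Variable F : finFieldType.
Local Notation gT := {'GL_2[F]}.
Implicit Types u v : gT.
Local Open Scope ring_scope.

Definition entry u (i j : 'I_2) : F := GLval u i j.
Local Notation i1 := (ord_max : 'I_2).
Definition ea u := entry u ord0 ord0.
Definition eb u := entry u ord0 i1.
Definition ec u := entry u i1 ord0.
Definition ed u := entry u i1 i1.

Lemma entry_ext u v : ea u = ea v -> eb u = eb v -> ec u = ec v -> ed u = ed v -> u = v.
Proof.
move=> Ha Hb Hc Hd; apply: val_inj; apply/matrixP => i j.
have I2 (k : 'I_2) : k = ord0 \/ k = i1.
  by case: k => [[|[|k]] Hk] //; [left | right]; apply: val_inj.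
by case: (I2 i) => ->; case: (I2 j) => ->.
Qed.

Lemma entryM u v i j :
  entry (u * v)%g i j = entry u i ord0 * entry v ord0 j + entry u i i1 * entry v i1 j.
Proof.
rewrite /entry GL_MxE mxE big_ord_recl big_ord1.
by congr (_ + GLval u _ _ * GLval v _ _); apply: val_inj.
Qed.

Lemma entries1 : (ea 1%g = 1) * (eb 1%g = 0) * (ec 1%g = 0) * (ed 1%g = 1).
Proof. by rewrite /ea /eb /ec /ed /entry GL_1E !mxE. Qed.

Lemma entriesM u v :
  (ea (u * v)%g = ea u * ea v + eb u * ec v) * (eb (u * v)%g = ea u * eb v + eb u * ed v)
  * (ec (u * v)%g = ec u * ea v + ed u * ec v) * (ed (u * v)%g = ec u * eb v + ed u * ed v).
Proof. by rewrite /ea /eb /ec /ed !entryM. Qed.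

Lemma det_entries u : (\det (GLval u) == 1) = (ea u * ed u - eb u * ec u == 1).
Proof.
rewrite (expand_det_row _ ord0) big_ord_recl big_ord1 /cofactor !det_mx11 !mxE /=.
rewrite addn0 expr0 expr1 mul1r mulN1r mulrN /ea /eb /ec /ed /entry.
have -> : lift ord0 ord0 = ord_max :> 'I_2 by apply: val_inj.
by have -> : lift ord_max ord0 = ord0 :> 'I_2 by apply: val_inj.
Qed.

(** Total in the entries: a singular matrix is replaced by the identity. *)
Definition slmx (a b c d : F) : gT :=
  @insubd _ _ gT (1%g : gT) (\matrix_(i < 2, j < 2)
    if i == ord0 then (if j == ord0 then a else b) else (if j == ord0 then c else d)).

Lemma slmxE a b c d : a * d - b * c = 1 ->
  (ea (slmx a b c d) = a) * (eb (slmx a b c d) = b) * (ec (slmx a b c d) = c)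
  * (ed (slmx a b c d) = d).
Proof.
move=> det1; rewrite /slmx.
set M := \matrix_(i, j) _.
have uM : M \is a GRing.unit.
  rewrite unitmxE (expand_det_row _ ord0) big_ord_recl big_ord1 /cofactor !det_mx11 !mxE /=.
  by rewrite addn0 expr0 expr1 mul1r mulN1r mulrN det1 unitr1.
have E : GLval (@insubd _ _ gT (1%g : gT) M) = M by exact: (@insubdK _ _ gT).
by rewrite /ea /eb /ec /ed /entry E !mxE /=.
Qed.

End GL2Entries.

(** * SL(2,p) in coordinates *)

Section SL2.
Local Open Scope group_scope.
Variables (p : nat) (F : finFieldType).
Hypotheses (hp : prime p) (hp5 : 5 < p) (cardF : #|F| = p) (pcharF : p \in [pchar F]%R).
Variables (gT : finGroupType) (L : {group gT}).
(** Elements are accessible only through abstract entry functions, so identities between them become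
    polynomial identities. *)
Variables (ea eb ec ed : gT -> F) (slmx : F -> F -> F -> F -> gT).
Implicit Types u v x y z : gT.

Local Open Scope ring_scope.
Hypothesis entry_ext : forall u v,
  ea u = ea v -> eb u = eb v -> ec u = ec v -> ed u = ed v -> u = v.
Hypothesis entries1 : (ea 1%g = 1) * (eb 1%g = 0) * (ec 1%g = 0) * (ed 1%g = 1).
Hypothesis entriesM : forall u v,
  (ea (u * v)%g = ea u * ea v + eb u * ec v) * (eb (u * v)%g = ea u * eb v + eb u * ed v)
  * (ec (u * v)%g = ec u * ea v + ed u * ec v) * (ed (u * v)%g = ec u * eb v + ed u * ed v).
Hypothesis mem_det1 : forall u, (u \in L) = (ea u * ed u - eb u * ec u == 1).
Hypothesis slmxE : forall a b c d, a * d - b * c = 1 ->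
  (ea (slmx a b c d) = a) * (eb (slmx a b c d) = b) * (ec (slmx a b c d) = c)
  * (ed (slmx a b c d) = d).
Hypothesis logn_card_le1 : (logn p #|L| <= 1)%N.

Lemma SL2_det u : u \in L -> ea u * ed u = 1 + eb u * ec u.
Proof. by rewrite mem_det1 subr_eq => /eqP. Qed.

Lemma slmx_SL2 a b c d : a * d - b * c = 1 -> slmx a b c d \in L.
Proof. by move=> h; rewrite mem_det1 !slmxE ?h. Qed.

Lemma entriesV u : u \in L ->
  (ea u^-1%g = ed u) * (eb u^-1%g = - eb u) * (ec u^-1%g = - ec u) * (ed u^-1%g = ea u).
Proof.
move=> /SL2_det d.
have dV : ed u * ea u - (- eb u) * (- ec u) = 1 by ring: d.
suff -> : u^-1%g = slmx (ed u) (- eb u) (- ec u) (ea u) by rewrite !slmxE.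
apply: (mulgI u); rewrite mulgV.
by apply: entry_ext; rewrite !entriesM !entries1 !(slmxE dV); ring: d.
Qed.

Local Open Scope ring_scope.

Lemma natr_neq0 (n : nat) : (0 < n < p)%N -> (n%:R : F) != 0.
Proof.
move=> /andP[n0 np]; rewrite -(dvdn_pcharf pcharF).
by rewrite gtnNdvd.
Qed.

Definition upper (t : F) : gT := slmx 1 t 0 1.
Definition lower (t : F) : gT := slmx 1 0 t 1.

Lemma upperE t : (ea (upper t) = 1) * (eb (upper t) = t) * (ec (upper t) = 0) * (ed (upper t) = 1).
Proof. by rewrite !slmxE //; ring. Qed.

Lemma lowerE t : (ea (lower t) = 1) * (eb (lower t) = 0) * (ec (lower t) = t) * (ed (lower t) = 1).
Proof. by rewrite !slmxE //; ring. Qed.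

Lemma upper_SL2 t : upper t \in L. Proof. by apply: slmx_SL2; ring. Qed.

Lemma lower_SL2 t : lower t \in L. Proof. by apply: slmx_SL2; ring. Qed.

(** * Commutation, center and conjugation *)

(** Commuting means that the traceless parts, recorded by [(b, c, a - d)], have zero cross
    product. *)
Lemma commute_entries x y : commute x y ->
  [/\ eb x * ec y = ec x * eb y, (ea x - ed x) * eb y = eb x * (ea y - ed y)
    & (ea x - ed x) * ec y = ec x * (ea y - ed y)].
Proof.
move=> xy.
have := congr1 ea xy; have := congr1 eb xy; have := congr1 ec xy.
rewrite !entriesM => h3 h2 h1; split.
- by apply: (lincomb1 (k1 := 1) h1); ring.
- by apply: (lincomb1 (k1 := 1) h2); ring.
by apply: (lincomb1 (k1 := -1) h3); ring.
Qed.

Lemma entries_commute x y :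
  eb x * ec y = ec x * eb y -> (ea x - ed x) * eb y = eb x * (ea y - ed y) ->
  (ea x - ed x) * ec y = ec x * (ea y - ed y) -> commute x y.
Proof.
move=> h1 h2 h3; apply: entry_ext; rewrite !entriesM.
- by apply: (lincomb1 (k1 := 1) h1); ring.
- by apply: (lincomb1 (k1 := 1) h2); ring.
- by apply: (lincomb1 (k1 := -1) h3); ring.
by apply: (lincomb1 (k1 := -1) h1); ring.
Qed.

Lemma mem_center x : x \in L ->
  (x \in 'Z(L)) = [&& eb x == 0, ec x == 0 & ea x - ed x == 0].
Proof.
move=> Lx; apply/idP/idP.
  case/centerP => _ cx.
  have [h1 h2 _] := commute_entries (cx _ (upper_SL2 1)).
  have [h3 _ _] := commute_entries (cx _ (lower_SL2 1)).
  rewrite !upperE !lowerE in h1 h2 h3.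
  by move: h1 h2 h3; rewrite !mulr0 !mulr1 subrr mulr0 => <- -> ->; rewrite eqxx.
case/and3P => /eqP b0 /eqP c0 /eqP e0; apply/centerP; split=> // y _.
by apply: entries_commute; rewrite ?b0 ?c0 ?e0 !mul0r.
Qed.

Lemma noncentral_commute_trans x y z : x \in L -> x \notin 'Z(L) ->
  commute x y -> commute x z -> commute y z.
Proof.
move=> Lx; rewrite mem_center // => nz /commute_entries[h1 h2 h3] /commute_entries[h4 h5 h6].
have [g1 g2 g3] := parallel_trans nz h1 h2 h3 h4 h5 h6.
exact: entries_commute.
Qed.

Lemma center_SL2 : 'Z(L) = [set slmx 1 0 0 1; slmx (-1) 0 0 (-1)].
Proof.
apply/setP => x; rewrite in_set2; apply/idP/idP.
  move=> Zx; have Lx : x \in L := subsetP (center_sub _) _ Zx.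
  move: Zx; rewrite mem_center // => /and3P[/eqP b0 /eqP c0]; rewrite subr_eq0 => /eqP ad.
  have := SL2_det Lx; rewrite b0 c0 -ad mul0r addr0 -expr2 => /eqP; rewrite sqrf_eq1.
  have d1 : (1 : F) * 1 - 0 * 0 = 1 by ring.
  have d2 : (-1 : F) * -1 - 0 * 0 = 1 by ring.
  by case/orP => /eqP a1; apply/orP; [left | right]; apply/eqP; apply: entry_ext;
    rewrite slmxE -?ad ?a1.
have d1 : (1 : F) * 1 - 0 * 0 = 1 by ring.
have d2 : (-1 : F) * -1 - 0 * 0 = 1 by ring.
by case/orP => /eqP->; rewrite mem_center ?slmx_SL2 // !slmxE // subrr eqxx.
Qed.

Lemma card_center_SL2 : #|'Z(L)| = 2.
Proof.
rewrite center_SL2 cards2.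
suff -> : slmx 1 0 0 1 != slmx (-1) 0 0 (-1) :> gT by [].
apply/eqP => /(congr1 ea); rewrite !slmxE; [|ring..].
move/eqP; rewrite eq_sym -subr_eq0 -opprD oppr_eq0 -(natrD _ 1 1).
by apply/negP/natr_neq0; lia.
Qed.

(** The discriminant of the characteristic polynomial is a quadratic form in the traceless part. *)
Lemma SL2_disc x : x \in L ->
  (ea x + ed x) ^+ 2 - 4%:R = (ea x - ed x) ^+ 2 + 4%:R * (eb x * ec x).
Proof. by move/SL2_det => d; apply: (lincomb1 (k1 := 4%:R) d); ring. Qed.

Lemma traceJ x y : y \in L -> ea (x ^ y)%g + ed (x ^ y)%g = ea x + ed x.
Proof.
move=> Ly; rewrite conjgE !entriesM !(entriesV Ly).
by apply: (lincomb1 (k1 := ea x + ed x) (SL2_det Ly)); ring.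
Qed.

(* The trace and the commutation relation leave only the two roots of
   the characteristic polynomial of [x] in the algebra [F[x]]. *)
Lemma conj_commute x y : x \in L -> x \notin 'Z(L) -> (ea x + ed x) ^+ 2 != 4%:R ->
  y \in L -> commute x (x ^ y)%g -> (x ^ y = x \/ x ^ y = x^-1)%g.
Proof.
move=> Lx; rewrite mem_center // => nz disc Ly /commute_entries[].
have := traceJ x Ly; have : (x ^ y)%g \in L by rewrite groupJ.
move: (x ^ y)%g => z Lz tr h1 h2 h3.
have [k [kb kc ke]] : exists k, [/\ eb z = k * eb x, ec z = k * ec x
    & ea z - ed z = k * (ea x - ed x)].
  have [b0|bnz] := eqVneq (eb x) 0; last first.
    exists (eb z / eb x); split; apply: (mulfI bnz).
    - by field.
    - by rewrite h1; field.
    by rewrite -h2; field.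
  have [c0|cnz] := eqVneq (ec x) 0; last first.
    exists (ec z / ec x); split; apply: (mulfI cnz).
    - by rewrite -h1; field.
    - by field.
    by rewrite -h3; field.
  have enz : ea x - ed x != 0 by move: nz; rewrite b0 c0 !eqxx.
  exists ((ea z - ed z) / (ea x - ed x)); split; apply: (mulfI enz).
  - by rewrite h2; field.
  - by rewrite h3; field.
  by field.
(* Conjugates have equal discriminants, and scaling the traceless part by [k] multiplies a nonzero
   discriminant by [k ^+ 2]. *)
have k2 : k ^+ 2 = 1.
  have := SL2_disc Lz; rewrite tr (SL2_disc Lx) kb kc ke => h.
  have dnz : (ea x - ed x) ^+ 2 + 4%:R * (eb x * ec x) != 0.
    by rewrite -(SL2_disc Lx) subr_eq0.
  by apply: (mulfI dnz); rewrite mulr1 [RHS]h; ring.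
have two : (2%:R : F) != 0 by apply: natr_neq0; lia.
move/eqP: k2; rewrite sqrf_eq1 => /orP[] /eqP k1.
  rewrite k1 !mul1r in kb kc ke.
  by left; apply: entry_ext => //; apply: (mulfI two);
    [apply: (lincomb2 (k1 := 1) (k2 := 1) tr ke) | apply: (lincomb2 (k1 := 1) (k2 := -1) tr ke)]; ring.
rewrite k1 !mulN1r in kb kc ke.
by right; apply: entry_ext; rewrite !(entriesV Lx) //; apply: (mulfI two);
  [apply: (lincomb2 (k1 := 1) (k2 := 1) tr ke) | apply: (lincomb2 (k1 := 1) (k2 := -1) tr ke)]; ring.
Qed.

(** * Unipotent elements and elements of order prime to p *)

(** Trace 2 and determinant 1 make [y - 1] square to zero, so the binomial expansion stops after the
    linear term. *)
Lemma unipotent_expg y n : y \in L -> ea y + ed y = 2%:R ->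
  [/\ ea (y ^+ n)%g = 1 + n%:R * (ea y - 1), eb (y ^+ n)%g = n%:R * eb y,
      ec (y ^+ n)%g = n%:R * ec y & ed (y ^+ n)%g = 1 + n%:R * (ed y - 1)].
Proof.
move=> Ly tr; have d := SL2_det Ly.
have dE : ed y = 2%:R - ea y by rewrite -tr; ring.
rewrite dE in d *.
elim: n => [|n [ha hb hc hd]]; first by rewrite expg0 !entries1; split; ring.
rewrite expgS !entriesM ha hb hc hd !dE -natr1.
by split; first [ring | apply: (lincomb1 (k1 := n%:R) d); ring
  | apply: (lincomb1 (k1 := - n%:R) d); ring].
Qed.

Lemma unipotent_expgp y : y \in L -> ea y + ed y = 2%:R -> (y ^+ p = 1)%g.
Proof.
move=> Ly /(unipotent_expg p Ly)[].
rewrite (pcharf0 pcharF) !mul0r addr0 => ha hb hc hd.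
by apply: entry_ext; rewrite entries1.
Qed.

(** If the squared trace is 4, then [x ^+ 2] has trace 2 and order dividing [p], so it is 1. Its
    off-diagonal entries are those of [x] times the nonzero trace, so [x] is diagonal, and the
    discriminant makes it scalar. *)
Lemma p'elt_trace x : x \in L -> x \notin 'Z(L) -> ~~ (p %| #[x]%g)%N ->
  (ea x + ed x) ^+ 2 != 4%:R.
Proof.
move=> Lx nZ p'x; apply: contraNneq nZ => tr2; rewrite mem_center //.
have e0 : (ea x - ed x) ^+ 2 = - (4%:R * (eb x * ec x)).
  by have := SL2_disc Lx; rewrite tr2 subrr => h; apply: (lincomb1 (k1 := -1) h); ring.
have d := SL2_det Lx.
have x2p : (x ^+ 2 ^+ p = 1)%g.
  apply: unipotent_expgp; first exact: groupX.
  rewrite expgS expg1 !entriesM; apply: (lincomb2 (k1 := 1) (k2 := -2%:R) tr2 d); ring.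
have x2 : (x ^+ 2 = 1)%g.
  apply/eqP; rewrite -order_dvdn -(@Gauss_dvdl _ _ p).
    by rewrite order_dvdn expgM x2p.
  by rewrite coprime_sym prime_coprime.
have tnz : ea x + ed x != 0.
  by rewrite -sqrf_eq0 tr2; apply: natr_neq0; lia.
have b0 : eb x = 0.
  apply: (mulfI tnz); rewrite mulr0.
  by have := congr1 eb x2; rewrite expgS expg1 !entriesM entries1 => <-; ring.
have c0 : ec x = 0.
  apply: (mulfI tnz); rewrite mulr0.
  by have := congr1 ec x2; rewrite expgS expg1 !entriesM entries1 => <-; ring.
by move/eqP: e0; rewrite b0 c0 mul0r mulr0 oppr0 sqrf_eq0 !eqxx.
Qed.

Local Close Scope ring_scope.

(** * Transvections and generation *)

Local Notation P := <[upper 1%R]>%g.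

Lemma upperX t n : (upper t ^+ n = upper (n%:R * t)%R)%g.
Proof.
elim: n => [|n IH]; first by apply: entry_ext; rewrite expg0 !entries1 !upperE ?mul0r.
rewrite expgS IH -[n.+1]add1n natrD mulrDl mul1r.
by apply: entry_ext; rewrite !entriesM !upperE; ring.
Qed.

Lemma order_upper : #[upper 1%R] = p.
Proof.
apply: nt_prime_order => //; last first.
  apply/eqP => /(congr1 eb); rewrite !upperE entries1 => /eqP.
  by rewrite oner_eq0.
by apply: unipotent_expgp; rewrite ?upper_SL2 // !upperE.
Qed.

Lemma upperP u : reflect (exists t, u = upper t) (u \in P).
Proof.
have defP : P = [set upper t | t : F].
  apply/eqP; rewrite eqEcard; apply/andP; split.
    apply/subsetP => _ /cycleP[n ->]; rewrite upperX mulr1.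
    by apply/imsetP; exists n%:R%R.
  by rewrite -orderE order_upper -cardF leq_imset_card.
rewrite defP; apply: (iffP imsetP) => [[t _ ->]|[t ->]]; by exists t.
Qed.

Lemma mem_upper t : upper t \in P.
Proof. by apply/upperP; exists t. Qed.

Lemma upper_subL : P \subset L.
Proof. by rewrite cycle_subG upper_SL2. Qed.

Lemma norm_upper u : u \in L -> ec u = 0%R -> u \in 'N(P).
Proof.
move=> Lu c0; rewrite inE -cycleJ cycle_subG.
have d := SL2_det Lu; rewrite c0 mulr0 addr0 in d.
suff -> : (upper 1%R ^ u = upper (ed u ^+ 2)%R)%g by apply: mem_upper.
apply: entry_ext; rewrite conjgE !entriesM !(entriesV Lu) !upperE ?c0;
  first [ring | by apply: (lincomb1 (k1 := 1%R) d); ring].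
Qed.

(** A nonzero lower left entry allows a factorisation upper, lower, upper; a zero one becomes
    nonzero after multiplication by [lower 1]. *)
Lemma transvections_generate (H : {group gT}) :
  P \subset H -> (forall t, lower t \in H) -> L \subset H.
Proof.
move=> sPH lowH.
have uppH t : upper t \in H by apply: (subsetP sPH); apply: mem_upper.
have gen u : u \in L -> ec u != 0%R -> u \in H.
  move=> Lu cnz; have d := SL2_det Lu.
  have -> : (u = upper ((ea u - 1) / ec u)%R * lower (ec u) * upper ((ed u - 1) / ec u)%R)%g.
    apply: entry_ext; rewrite !entriesM !upperE !lowerE; try by field.
    by apply: (mulfI cnz); apply: (lincomb1 (k1 := (-1)%R) d); field.
  by rewrite !groupM.
apply/subsetP => u Lu; have [c0|] := eqVneq (ec u) 0%R; last exact: gen.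
rewrite -(groupMr _ (lowH 1%R)); apply: gen; first by rewrite groupM ?lower_SL2.
rewrite entriesM !lowerE c0 mul0r add0r mulr1.
apply: contraTneq isT => d0; have := SL2_det Lu.
by rewrite d0 c0 !mulr0 addr0 => /esym/eqP; rewrite oner_eq0.
Qed.

(** Upper transvections on both sides clear the diagonal of [h]; the resulting antidiagonal [w]
    conjugates upper transvections to lower ones. *)
Lemma bruhat_generate (H : {group gT}) h : P \subset H -> h \in H -> h \in L ->
  ec h != 0%R -> L \subset H.
Proof.
move=> sPH Hh Lh cnz; apply: transvections_generate => // t.
have uppH s : upper s \in H by apply: (subsetP sPH); apply: mem_upper.
pose w := (upper (- ea h / ec h)%R * h * upper (- ed h / ec h)%R)%g.
have Hw : w \in H by rewrite !groupM.
have Lw : w \in L by rewrite !groupM ?upper_SL2.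
have [wa wb wc wd] : [/\ ea w = 0, eb w = - (ec h)^-1, ec w = ec h & ed w = 0]%R.
  split; rewrite /w !entriesM !upperE; try by field.
  by apply: (mulfI cnz); apply: (lincomb1 (k1 := (-1)%R) (SL2_det Lh)); field.
clearbody w; suff -> : lower t = (upper (- t / ec h ^+ 2)%R ^ w)%g by rewrite groupJ.
by apply: entry_ext; rewrite conjgE !entriesM !(entriesV Lw) !upperE !lowerE ?wa ?wb ?wc ?wd; field.
Qed.

Lemma der_norm_upper : 'N_L(P)^`(1)%g \subset P.
Proof.
(* Conjugating [upper 1] by [u] produces the lower left entry [- ec u ^+ 2], so the normaliser is
   triangular and its commutators are unipotent. *)
have cN u : u \in 'N_L(P) -> ec u = 0%R.
  case/setIP => Lu Nu; have := memJ_norm (upper 1%R) Nu.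
  rewrite cycle_id => /upperP[t /(congr1 ec)].
  rewrite conjgE !entriesM !(entriesV Lu) !upperE.
  move=> e; apply/eqP; rewrite -sqrf_eq0; apply/eqP.
  by apply: (lincomb1 (k1 := (-1)%R) e); ring.
rewrite derg1 gen_subG; apply/subsetP => _ /imset2P[u v Nu Nv ->].
have [Lu Lv] : u \in L /\ v \in L by case/setIP: Nu; case/setIP: Nv.
have [cu cv] := (cN _ Nu, cN _ Nv).
have du := SL2_det Lu; rewrite cu mulr0 addr0 in du.
have dv := SL2_det Lv; rewrite cv mulr0 addr0 in dv.
suff -> : [~ u, v] = upper (eb [~ u, v]) by apply: mem_upper.
by apply: entry_ext; rewrite !upperE // commgEl conjgE !entriesM !(entriesV Lu, entriesV Lv) ?cu ?cv;
  first [ring | apply: (lincomb2 (k1 := (ea v * ed v)%R) (k2 := 1%R) du dv); ring].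
Qed.

(** * Perfectness and normal subgroups *)

Lemma SL2_perfect : L^`(1)%g = L.
Proof.
have two : (2%:R != 0 :> F)%R by apply: natr_neq0; lia.
have three : (3%:R != 0 :> F)%R by apply: natr_neq0; lia.
have dD : (2%:R * (2%:R)^-1 - 0 * 0 = 1 :> F)%R by field.
(* Commutation with diag(2, 1/2) multiplies the parameter of an upper transvection by 3/4 and of a
   lower one by -3, whence the arguments 4/3 and [- t / 3]. *)
pose D : gT := slmx 2%:R%R 0%R 0%R (2%:R^-1)%R.
have LD : D \in L by apply: slmx_SL2.
apply/eqP; rewrite eqEsubset der_sub /=; apply: transvections_generate => [|t].
  rewrite cycle_subG; suff -> : upper 1%R = [~ D, upper (4%:R / 3%:R)%R].
    by rewrite mem_commg ?upper_SL2.
  apply: entry_ext; rewrite commgEl conjgE !entriesM !(entriesV LD)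
    !(entriesV (upper_SL2 _)) !upperE !(slmxE dD); field; by rewrite ?two ?three.
suff -> : lower t = [~ D, lower (- t / 3%:R)%R] by rewrite mem_commg ?lower_SL2.
by apply: entry_ext; rewrite commgEl conjgE !entriesM !(entriesV LD)
    !(entriesV (lower_SL2 _)) !lowerE !(slmxE dD); field; rewrite ?two ?three.
Qed.

(** An element of [N] with nonzero lower left entry generates [L] together with [P], so [L / N] is
    cyclic and perfectness gives [N = L]. If there is none, conjugation by [lower 1] and
    [lower (-1)] shows that [N] is scalar. *)
Lemma SL2_quasisimple (N : {group gT}) : N <| L -> ~~ (N \subset 'Z(L)) -> N :=: L.
Proof.
move=> nNL ncN; have [sNL nN] := andP nNL.
have nPN : P \subset 'N(N) := subset_trans upper_subL nN.
apply/eqP; rewrite eqEsubset sNL /= -SL2_perfect; apply: der1_min => //.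
have [h /andP[Nh cnz]|c0] := pickP [pred h in N | ec h != 0%R]; last first.
  case/negP: ncN; apply/subsetP => h Nh; have Lh := subsetP sNL _ Nh.
  have cN x : x \in N -> ec x = 0%R.
    by move=> Nx; apply/eqP; have := c0 x; rewrite /= Nx => /negbFE.
  have cJ k : (k * (ed h - ea h) - k ^+ 2 * eb h = 0)%R.
    have Nhk : h ^ lower k \in N by rewrite memJ_norm // (subsetP nN) ?lower_SL2.
    have := cN _ Nhk; rewrite conjgE !entriesM !(entriesV (lower_SL2 _)) !lowerE.
    by rewrite (cN _ Nh) => <-; ring.
  have two : (2%:R != 0 :> F)%R by apply: natr_neq0; lia.
  have b0 : eb h = 0%R.
    by apply: (mulfI two); apply: (lincomb2 (k1 := (-1)%R) (k2 := (-1)%R) (cJ 1%R) (cJ (-1)%R)); ring.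
  rewrite mem_center // b0 (cN _ Nh) !eqxx /=; apply/eqP.
  by apply: (lincomb1 (k1 := (-1)%R) (cJ 1%R)); rewrite b0; ring.
have sLNP : L \subset P <*> N.
  by apply: (bruhat_generate (h := h)) => //; rewrite ?joing_subl ?(subsetP (joing_subr _ _)) ?(subsetP sNL).
apply: abelianS (quotientS N sLNP) _.
by rewrite quotientYidr // quotient_abelian // cycle_abelian.
Qed.

(** * Sylow subgroups and involutions modulo the center *)

Lemma logn_card_SL2 : logn p #|L| = 1%N.
Proof.
apply/eqP; rewrite eqn_leq logn_card_le1 -(pfactor_dvdn 1) ?cardG_gt0 //.
by rewrite expn1 -order_upper order_dvdG ?upper_SL2.
Qed.

Lemma Sylow_upper : p.-Sylow(L) P.
Proof.
by rewrite pHallE upper_subL p_part logn_card_SL2 expn1 -orderE order_upper /=.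
Qed.

(** Up to conjugation [H] contains [P]; being proper, it has no element with nonzero lower left
    entry, so it normalises [P]. *)
Lemma p_subgroup (H : {group gT}) : H \subset L -> p %| #|H| -> ~~ (L \subset H) ->
  exists Q : {group gT}, [/\ p.-Sylow(L) Q, Q \subset H, H \subset 'N(Q) & 'N_L(Q)^`(1) \subset Q].
Proof.
move=> sHL pH pr; have [x Hx ox] := Cauchy hp pH.
have [y Ly sQP] : exists2 y, y \in L & <[x]> \subset P :^ y.
  apply: (Sylow_subJ Sylow_upper); first by rewrite cycle_subG (subsetP sHL).
  by rewrite /pgroup -orderE ox pnat_id.
have cJ : #|P :^ y| = p by rewrite cardJg -orderE order_upper.
exists (P :^ y)%G; have eQ : <[x]> = P :^ y.
  by apply/eqP; rewrite eqEcard sQP cJ -ox /=.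
have sPH : P \subset H :^ y^-1 by rewrite -sub_conjg -eQ cycle_subG.
have Lyi : L :^ y^-1 = L by rewrite conjGid // groupV.
split=> //.
- by rewrite pHallJ // Sylow_upper.
- by rewrite /= -eQ cycle_subG.
- rewrite /= normJ -sub_conjgV; apply/subsetP => h Hh.
  have Lh : h \in L by rewrite -Lyi; apply: (subsetP _ _ Hh); rewrite conjSg.
  apply: norm_upper => //; apply/eqP; apply: contraNT pr => cnz.
  by have := bruhat_generate sPH Hh Lh cnz; rewrite -{1}Lyi conjSg.
have LJ : L :^ y = L by rewrite conjGid.
by rewrite /= normJ -{1}LJ -conjIg derJ conjSg der_norm_upper.
Qed.

(** By the Cayley-Hamilton theorem the square is [-1]. *)
Lemma trace0_sqr u : u \in L -> (ea u + ed u = 0)%R -> u ^+ 2 \in 'Z(L).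
Proof.
move=> Lu tr; rewrite mem_center ?groupX // expgS expg1 !entriesM.
have -> : ed u = (- ea u)%R by apply: (lincomb1 (k1 := 1%R) tr); ring.
by apply/and3P; split; apply/eqP; ring.
Qed.

(* The three trace-zero matrices come from the solution [x = y = 1, t = 3] of
   [x ^ 2 + y ^ 2 + 1 = t x y], chosen to make [i * j^-1 * k] a transvection. *)
Lemma three_involutions : exists i j k,
  [/\ [/\ i \in L, j \in L & k \in L],
      [/\ i ^+ 2 \in 'Z(L), j ^+ 2 \in 'Z(L) & k ^+ 2 \in 'Z(L)] &
      L \subset <<[set i; j; k]>>].
Proof.
have three : (3%:R != 0 :> F)%R by apply: natr_neq0; lia.
have di : (0 * 0 - 1 * -1 = 1 :> F)%R by ring.
have dj : (1 * -1 - 1 * - 2%:R = 1 :> F)%R by ring.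
have dk : (1 * -1 - 2%:R * -1 = 1 :> F)%R by ring.
have [Li Lj Lk] := And3 (slmx_SL2 di) (slmx_SL2 dj) (slmx_SL2 dk).
move: (slmxE di) (slmxE dj) (slmxE dk) Li Lj Lk.
move: (slmx 0 1 (-1) 0)%R (slmx 1 1 (- 2%:R) (-1))%R (slmx 1 2%:R (-1) (-1))%R.
move=> i j k iE jE kE Li Lj Lk.
exists i, j, k; split=> //.
  by split; apply: trace0_sqr; rewrite // ?iE ?jE ?kE; ring.
pose H := <<[set i; j; k]>>%G; rewrite -[<<_>>]/(gval H).
have [Hi Hj Hk] : [/\ i \in H, j \in H & k \in H].
  by split; apply: mem_gen; rewrite !inE eqxx ?orbT.
have H3 : upper 3%:R%R \in H.
  suff -> : upper 3%:R%R = i * j^-1 * k by rewrite !groupM ?groupV.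
  by apply: entry_ext; rewrite !entriesM !(entriesV Lj) !upperE !iE !jE !kE; ring.
(* Since 3 is nonzero in [F], [upper 3] is a nontrivial element of [P], a group of prime order. *)
have sPH : P \subset H.
  apply: contraT => nPH; have pP : prime #|P| by rewrite -orderE order_upper.
  have : upper 3%:R%R \in P :&: H by rewrite inE mem_upper.
  rewrite (prime_TIg pP nPH) => /set1P/(congr1 eb).
  by rewrite upperE entries1 => /eqP; rewrite (negbTE three).
by apply: (bruhat_generate sPH Hi Li); rewrite iE oppr_eq0 oner_eq0.
Qed.

Lemma PSL2_witness_order g : witness_to_failure (L / 'Z(L))%G g -> 3 <= #[g] ->
  4 <= #[g] \/ ~~ (5 %| #|L|)%N -> False.
Proof.
apply: (witness_order (p := p)) => //.
- exact: card_center_SL2.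
- exact: noncentral_commute_trans.
- by move=> x y Lx nZx p'x; apply: conj_commute => //; apply: p'elt_trace.
- exact: SL2_perfect.
- exact: SL2_quasisimple.
- exact: p_subgroup.
- exact: logn_card_SL2.
exact: three_involutions.
Qed.

End SL2.

(** * Application to PSL(2,p) *)

Lemma PSL2_order_bound p (hp : prime p) (hp5 : 5 < p) g :
  witness_to_failure (PSL2 p) g -> 2 < #[g]%g ->
  3 < #[g]%g \/ ~~ (5 %| #|SL2 p|) -> False.
Proof.
have cardF : #|'F_p| = p := card_Fp hp.
apply: (PSL2_witness_order hp hp5 cardF (pchar_Fp hp) (@entry_ext 'F_p) (entries1 'F_p)
  (@entriesM 'F_p) _ (@slmxE 'F_p)).
  by move=> u; rewrite inE det_entries.
(* The bound comes from the order [p (p - 1)^2 (p + 1)] of GL(2,p), in which [p] occurs once. *)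
apply: leq_trans (dvdn_leq_log _ (cardG_gt0 _) (cardSg (subsetT _))) _.
rewrite card_GL_2 cardF !lognM ?muln_gt0 ?expn_gt0 ?lognX; try lia.
rewrite logn_prime // eqxx.
have -> : logn p p.-1 = 0 by apply/eqP; rewrite lognE; case: ifP => // /and3P[_ _ /dvdn_leq]; lia.
have -> // : logn p p.+1 = 0.
apply/eqP; rewrite lognE; case: ifP => // /and3P[_ _]; rewrite -addn1 dvdn_addr //.
by move/dvdn_leq; lia.
Qed.

(** If 5 divided [p (p - 1)^2 (p + 1)], then [p] would be 1 or -1 modulo 5, hence modulo 10 because
    [p] is odd. *)
Lemma five_ndvd_SL2 p : prime p -> 5 < p -> p %% 10 != 1 -> p %% 10 != 9 ->
  ~~ (5 %| #|SL2 p|).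
Proof.
move=> hp hp5 p1 p9; have cardF : #|'F_p| = p := card_Fp hp.
have p2 : ~~ (2 %| p) by rewrite dvdn_prime2 // neq_ltn; lia.
have p5 : ~~ (5 %| p) by rewrite dvdn_prime2 // neq_ltn; lia.
apply/negP => d5; have := dvdn_trans d5 (cardSg (subsetT (SL2 p))).
rewrite card_GL_2 cardF !Euclid_dvdM //.
by move: p1 p9 p2 p5; clear; lia.
Qed.

Theorem theorem2 (p : nat) (hp : prime p) (hp5 : 5 < p) :
  (forall g, witness_to_failure (PSL2 p) g -> #[g]%g = 2 \/ #[g]%g = 3) /\
  (p %% 10 != 1 -> p %% 10 != 9 ->
     forall g, witness_to_failure (PSL2 p) g -> #[g]%g = 2).
Proof.
have order_gt1 g : witness_to_failure (PSL2 p) g -> 1 < #[g]%g.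
  by case=> _ [ntg _]; rewrite order_gt1.
split=> [g wit | p1 p9 g wit].
  have g1 := order_gt1 g wit; have [g3|] := ltnP 3 #[g]%g; last by lia.
  by have := PSL2_order_bound hp hp5 wit (ltnW g3) (or_introl g3).
have g1 := order_gt1 g wit; have [g2|] := ltnP 2 #[g]%g; last by lia.
by have := PSL2_order_bound hp hp5 wit g2 (or_intror (five_ndvd_SL2 hp hp5 p1 p9)).
Qed.
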